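(* Let $\mathfrak C$ be a full class of $\mathcal L$-structures. The following are equivalent: (1) The relative support function $\mathrm{supp}_=$ is interpretable in all reduced products of structures from $\mathfrak C$. (2) The relative support function $\mathrm{supp}_=$ is interpretable in all atomless reduced products of structures from $\mathfrak C$. (3) The formula $x=x'\rightarrow y=y'$ is equivalent to an $h$-formula in the common theory $\mathrm{Th}(\mathfrak C)$ of $\mathfrak C$.
   Context: An ideal $\mathcal I$ on $\mathbb I$ is a family of subsets closed under subsets and finite unions not containing $\mathbb I$. The reduced product $\prod_{\mathcal I}\mathcal M_i$ is $\prod_i\mathcal M_i$ modulo $(a_i)\simeq(b_i)\iff\{i\mid a_i\neq b_i\}\in\mathcal I$, with a relation holding iff the set of coordinates where it fails is in $\mathcal I$, functions coordinatewise. It is atomless if the Boolean algebra $\mathcal P(\mathbb I)/\mathcal I$ is atomless. The relative support function of $\prod_{\mathcal I}\mathcal M_i$ is $\mathrm{supp}_=((a_i)_i,(b_i)_i)=[\{i\mid a_i=b_i\}]_{\mathcal I}\in\mathcal P(\mathbb I)/\mathcal I$ (interpretable together with the Boolean algebra $\mathcal P(\mathbb I)/\mathcal I$). A class is full if every relation symbol has nonempty interpretation in each member and each member has at least three elements. $h$-formulas: the smallest class of formulas containing atomic formulas and closed under $\varphi\wedge\psi$, $(\exists x)\varphi$, $(\forall x)\varphi$, and $(\exists x)\varphi\wedge(\forall x)(\varphi\to\psi)$. $\mathrm{Th}(\mathfrak C)$ is the set of sentences true in all members of $\mathfrak C$. *)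

(* Defs.v *)
From HB Require Import structures.
From mathcomp Require Import all_boot all_order.
From mathcomp Require Import boolp classical_sets.

Set Implicit Arguments.
Unset Strict Implicit.
Unset Printing Implicit Defensive.

Local Open Scope classical_set_scope.
Local Open Scope quotient_scope.

(* Constants are function symbols of arity 0. *)
Record language := Language {
  fsym : Type;
  farity : fsym -> nat;
  rsym : Type;
  rarity : rsym -> nat }.

Record structure (L : language) := Structure {
  carrier :> Type;
  carrier_inh : inhabited carrier;
  fun_interp : forall f : fsym L, ('I_(farity f) -> carrier) -> carrier;
  rel_interp : forall r : rsym L, ('I_(rarity r) -> carrier) -> Prop }.

(* [term L n] and [formula L n]: the free variables are among x_0, ..., x_{n-1}.
   A quantifier in [formula L n] binds the variable x_n of its body. *)
Inductive term (L : language) (n : nat) : Type :=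
  | Var of 'I_n
  | App (f : fsym L) of ('I_(farity f) -> term L n).
Arguments Var {L n}.

Inductive formula (L : language) : nat -> Type :=
  | Eq n : term L n -> term L n -> formula L n
  | Rel n (r : rsym L) : ('I_(rarity r) -> term L n) -> formula L n
  | Not n : formula L n -> formula L n
  | And n : formula L n -> formula L n -> formula L n
  | Or n : formula L n -> formula L n -> formula L n
  | Imp n : formula L n -> formula L n -> formula L n
  | Ex n : formula L n.+1 -> formula L n
  | All n : formula L n.+1 -> formula L n.

Definition vext (A : Type) n (v : 'I_n -> A) (x : A) : 'I_n.+1 -> A :=
  fun i => if unlift ord_max i is Some j then v j else x.

Fixpoint eval (L : language) (M : structure L) n (v : 'I_n -> M)
    (t : term L n) : M :=
  match t with
  | Var i => v i
  | App f ts => @fun_interp L M f (fun j => eval v (ts j))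
  end.

Fixpoint sat (L : language) (M : structure L) n (phi : formula L n) :
    ('I_n -> M) -> Prop :=
  match phi with
  | Eq _ s t => fun v => eval v s = eval v t
  | Rel _ r ts => fun v => @rel_interp L M r (fun j => eval v (ts j))
  | Not _ p => fun v => ~ sat p v
  | And _ p q => fun v => sat p v /\ sat q v
  | Or _ p q => fun v => sat p v \/ sat q v
  | Imp _ p q => fun v => sat p v -> sat q v
  | Ex _ p => fun v => exists x : M, sat p (vext v x)
  | All _ p => fun v => forall x : M, sat p (vext v x)
  end.

Inductive h_formula (L : language) : forall n, formula L n -> Prop :=
  | h_Eq n (s t : term L n) : h_formula (Eq s t)
  | h_Rel n (r : rsym L) (ts : 'I_(rarity r) -> term L n) :
      h_formula (Rel ts)
  | h_And n (p q : formula L n) :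
      h_formula p -> h_formula q -> h_formula (And p q)
  | h_Ex n (p : formula L n.+1) : h_formula p -> h_formula (Ex p)
  | h_All n (p : formula L n.+1) : h_formula p -> h_formula (All p)
  | h_ExAll n (p q : formula L n.+1) :
      h_formula p -> h_formula q -> h_formula (And (Ex p) (All (Imp p q))).

Definition sentence (L : language) := formula L 0.

Definition models (L : language) (M : structure L) (s : sentence L) : Prop :=
  forall v : 'I_0 -> M, sat s v.

Definition Th (L : language) (C : structure L -> Prop) (s : sentence L) : Prop :=
  forall M, C M -> models M s.

Definition equivalent_in (L : language) (T : sentence L -> Prop) n
    (phi psi : formula L n) : Prop :=
  forall N : structure L, (forall s, T s -> models N s) ->
  forall v : 'I_n -> N, sat phi v <-> sat psi v.

(* The formula x = x' -> y = y', with (x, x', y, y') = (x_0, x_1, x_2, x_3). *)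
Definition eq_imp_eq (L : language) : formula L 4 :=
  Imp (Eq (Var (@Ordinal 4 0 isT)) (Var (@Ordinal 4 1 isT)))
      (Eq (Var (@Ordinal 4 2 isT)) (Var (@Ordinal 4 3 isT))).

Definition full_class (L : language) (C : structure L -> Prop) : Prop :=
  forall M, C M ->
    (forall r : rsym L, exists a, @rel_interp L M r a) /\
    (exists x y z : M, [/\ x <> y, y <> z & x <> z]).

(* Closure under the empty union is [ideal_set0]. *)
Record ideal (X : Type) := Ideal {
  ideal_mem :> set X -> Prop;
  ideal_set0 : ideal_mem set0;
  ideal_sub : forall A B, A `<=` B -> ideal_mem B -> ideal_mem A;
  ideal_setU : forall A B, ideal_mem A -> ideal_mem B -> ideal_mem (A `|` B);
  ideal_proper : ~ ideal_mem setT }.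

Section PowersetModIdeal.
Variables (X : Type) (J : ideal X).

Definition set_equiv (A B : set X) : bool :=
  `[< J ((A `\` B) `|` (B `\` A)) >].

Lemma set_equivP A B :
  reflect (exists2 N, J N & forall x, ~ N x -> (A x <-> B x)) (set_equiv A B).
Proof.
apply: (iffP (asboolP _)) => [JAB|[N JN NAB]].
  exists ((A `\` B) `|` (B `\` A)) => // x nx; split=> [Ax|Bx].
    by apply: contrapT => nBx; apply: nx; left.
  by apply: contrapT => nAx; apply: nx; right.
apply: ideal_sub JN => x ABx; apply: contrapT => /NAB AB.
by case: ABx => -[P]; apply; apply/AB.
Qed.

Lemma set_equiv_refl : reflexive set_equiv.
Proof. by move=> A; apply/set_equivP; exists set0 => //; apply: ideal_set0. Qed.

Lemma set_equiv_sym : symmetric set_equiv.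
Proof. by move=> A B; rewrite /set_equiv setUC. Qed.

Lemma set_equiv_trans : transitive set_equiv.
Proof.
move=> B A C /set_equivP[N JN AB] /set_equivP[N' JN' BC]; apply/set_equivP.
exists (N `|` N'); first exact: ideal_setU.
by move=> x nx; rewrite AB ?BC // => Nx; apply: nx; [right|left].
Qed.

Canonical set_equiv_equiv :=
  EquivRel set_equiv set_equiv_refl set_equiv_sym set_equiv_trans.

(* The Boolean algebra P(X)/J. *)
Definition powerset_mod := {eq_quot set_equiv}.
HB.instance Definition _ := EqQuotient.on powerset_mod.
HB.instance Definition _ := Choice.on powerset_mod.

Definition pclass (A : set X) : powerset_mod := \pi_powerset_mod A.

Lemma pclassP A B :
  pclass A = pclass B <-> exists2 N, J N & forall x, ~ N x -> (A x <-> B x).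
Proof.
split=> [/eqmodP/set_equivP //|AB].
by apply/eqmodP; apply/set_equivP.
Qed.

Lemma pclass_repr (b : powerset_mod) : pclass (repr b) = b.
Proof. exact: reprK. Qed.

Lemma repr_pclass A : exists2 N, J N & forall x, ~ N x -> (repr (pclass A) x <-> A x).
Proof. by apply/pclassP; rewrite pclass_repr. Qed.

Definition pmeet (b c : powerset_mod) := pclass (repr b `&` repr c).
Definition pjoin (b c : powerset_mod) := pclass (repr b `|` repr c).
Definition pcompl (b : powerset_mod) := pclass (~` repr b).

Lemma pmeetE A B : pmeet (pclass A) (pclass B) = pclass (A `&` B).
Proof.
have [N JN NA] := repr_pclass A; have [N' JN' NB] := repr_pclass B.
apply/pclassP; exists (N `|` N'); first exact: ideal_setU.
by move=> x /not_orP[nx nx']; rewrite /setI/= NA // NB.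
Qed.

Lemma pjoinE A B : pjoin (pclass A) (pclass B) = pclass (A `|` B).
Proof.
have [N JN NA] := repr_pclass A; have [N' JN' NB] := repr_pclass B.
apply/pclassP; exists (N `|` N'); first exact: ideal_setU.
by move=> x /not_orP[nx nx']; rewrite /setU/= NA // NB.
Qed.

Lemma pcomplE A : pcompl (pclass A) = pclass (~` A).
Proof.
have [N JN NA] := repr_pclass A; apply/pclassP; exists N => // x nx.
by rewrite /setC/= NA.
Qed.

Lemma pclass_ind (P : powerset_mod -> Prop) :
  (forall A, P (pclass A)) -> forall b, P b.
Proof. by move=> PA b; rewrite -(pclass_repr b). Qed.

Definition ple (b c : powerset_mod) : bool := pmeet b c == b.
Definition plt (b c : powerset_mod) : bool := (c != b) && ple b c.

Fact pmeetC : commutative pmeet.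
Proof.
elim/pclass_ind=> A; elim/pclass_ind=> B.
by rewrite !pmeetE setIC.
Qed.

Fact pjoinC : commutative pjoin.
Proof.
elim/pclass_ind=> A; elim/pclass_ind=> B.
by rewrite !pjoinE setUC.
Qed.

Fact pmeetA : associative pmeet.
Proof.
elim/pclass_ind=> A; elim/pclass_ind=> B; elim/pclass_ind=> C.
by rewrite !pmeetE setIA.
Qed.

Fact pjoinA : associative pjoin.
Proof.
elim/pclass_ind=> A; elim/pclass_ind=> B; elim/pclass_ind=> C.
by rewrite !pjoinE setUA.
Qed.

Fact pjoinKI c b : pmeet b (pjoin b c) = b.
Proof.
elim/pclass_ind: b => A; elim/pclass_ind: c => B.
rewrite pjoinE pmeetE; congr pclass.
by apply/seteqP; split=> x /=; [case|split; [|left]].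
Qed.

Fact pmeetKU c b : pjoin b (pmeet b c) = b.
Proof.
elim/pclass_ind: b => A; elim/pclass_ind: c => B.
rewrite pmeetE pjoinE; congr pclass.
by apply/seteqP; split=> x /=; [case=> // -[]|left].
Qed.

Fact pmeetUl : left_distributive pmeet pjoin.
Proof.
elim/pclass_ind=> A; elim/pclass_ind=> B; elim/pclass_ind=> C.
by rewrite !(pjoinE, pmeetE) setIUl.
Qed.

Fact pmeetxx : idempotent_op pmeet.
Proof. by elim/pclass_ind=> A; rewrite pmeetE setIid. Qed.

HB.instance Definition _ :=
  Order.isMeetJoinDistrLattice.Build (Order.Disp tt tt) powerset_mod
    (le := ple) (lt := plt) (fun _ _ => erefl) (fun _ _ => erefl) pmeetC pjoinC pmeetA pjoinA
    pjoinKI pmeetKU pmeetUl pmeetxx.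

Fact ple0x b : (pclass set0 <= b)%O.
Proof.
elim/pclass_ind: b => A.
by apply/eqP; rewrite pmeetE set0I.
Qed.

Fact plex1 b : (b <= pclass setT)%O.
Proof.
elim/pclass_ind: b => A.
by apply/eqP; rewrite pmeetE setIT.
Qed.

HB.instance Definition _ := Order.hasBottom.Build _ powerset_mod ple0x.
HB.instance Definition _ := Order.hasTop.Build _ powerset_mod plex1.

Fact pjoinxC (b : powerset_mod) : (b `|` pcompl b = \top)%O.
Proof.
elim/pclass_ind: b => A.
by rewrite -[Order.join _ _]/(pjoin _ _) pcomplE pjoinE setUv.
Qed.

Fact pmeetxC (b : powerset_mod) : (b `&` pcompl b = \bot)%O.
Proof.
elim/pclass_ind: b => A.
by rewrite -[Order.meet _ _]/(pmeet _ _) pcomplE pmeetE setICr.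
Qed.

HB.instance Definition _ :=
  Order.TBDistrLattice_hasComplement.Build _ powerset_mod pjoinxC pmeetxC.

Lemma ple_pclass A B :
  (pclass A <= pclass B :> powerset_mod)%O <-> J (A `\` B).
Proof.
rewrite -[X in is_true X]/(pmeet _ _ == _) pmeetE; split.
  move=> /eqP/pclassP[N JN NAB]; apply: ideal_sub JN => x [Ax nBx].
  by apply: contrapT => /NAB[_ /(_ Ax)[]].
move=> JAB; apply/eqP/pclassP; exists (A `\` B) => // x nABx; split=> [[]//|Ax].
by split=> //; apply: contrapT => nBx; apply: nABx.
Qed.

End PowersetModIdeal.

Definition atom d (B : ctbDistrLatticeType d) (b : B) : Prop :=
  (\bot < b)%O /\ forall c : B, (c < b)%O -> c = \bot%O.

Definition atomless d (B : ctbDistrLatticeType d) : Prop :=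
  forall b : B, ~ atom b.

Section ReducedProduct.
Variables (L : language) (X : Type) (J : ideal X) (M : X -> structure L).

Definition dprod := forall i, M i.
HB.instance Definition _ := gen_eqMixin dprod.
HB.instance Definition _ := gen_choiceMixin dprod.

Definition prod_equiv (a b : dprod) : bool :=
  `[< J [set i | a i <> b i] >].

Lemma prod_equivP a b :
  reflect (exists2 N, J N & forall i, ~ N i -> a i = b i) (prod_equiv a b).
Proof.
apply: (iffP (asboolP _)) => [Jab|[N JN Nab]].
  by exists [set i | a i <> b i] => // i /contrapT.
by apply: ideal_sub JN => i /= abi; apply: contrapT => /Nab.
Qed.

Lemma prod_equiv_refl : reflexive prod_equiv.
Proof. by move=> a; apply/prod_equivP; exists set0 => //; apply: ideal_set0. Qed.

Lemma prod_equiv_sym : symmetric prod_equiv.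
Proof.
move=> a b; apply/idP/idP => /prod_equivP[N JN ab]; apply/prod_equivP;
by exists N => // i /ab.
Qed.

Lemma prod_equiv_trans : transitive prod_equiv.
Proof.
move=> b a c /prod_equivP[N JN ab] /prod_equivP[N' JN' bc]; apply/prod_equivP.
exists (N `|` N'); first exact: ideal_setU.
by move=> i /not_orP[nx nx']; rewrite ab ?bc.
Qed.

Canonical prod_equiv_equiv :=
  EquivRel prod_equiv prod_equiv_refl prod_equiv_sym prod_equiv_trans.

Definition rprod_carrier := {eq_quot prod_equiv}.
HB.instance Definition _ := EqQuotient.on rprod_carrier.
HB.instance Definition _ := Choice.on rprod_carrier.

Definition rclass (a : dprod) : rprod_carrier := \pi_rprod_carrier a.

Definition rprod_fun (f : fsym L) (a : 'I_(farity f) -> rprod_carrier) :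
    rprod_carrier :=
  rclass (fun i => @fun_interp L (M i) f (fun j => repr (a j) i)).

Definition rprod_rel (r : rsym L) (a : 'I_(rarity r) -> rprod_carrier) : Prop :=
  J [set i | ~ @rel_interp L (M i) r (fun j => repr (a j) i)].

Fact rprod_inh : inhabited rprod_carrier.
Proof.
exact: (inhabits (rclass (fun i => inhabited_witness (carrier_inh (M i))))).
Qed.

Definition reduced_product : structure L :=
  Structure rprod_inh rprod_fun rprod_rel.

(* supp_= of the reduced product. *)
Definition supp_eq (a b : reduced_product) : powerset_mod J :=
  pclass J [set i | repr (a : rprod_carrier) i = repr (b : rprod_carrier) i].

(* The definitions above do not depend on the representatives. *)

Lemma rclassP a b :
  rclass a = rclass b <-> exists2 N, J N & forall i, ~ N i -> a i = b i.
Proof.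
split=> [/eqmodP/prod_equivP //|ab].
by apply/eqmodP; apply/prod_equivP.
Qed.

Lemma repr_rclass a : exists2 N, J N & forall i, ~ N i -> repr (rclass a) i = a i.
Proof. by apply/rclassP; apply: reprK. Qed.

Lemma repr_rclass_tuple n (a : 'I_n -> dprod) :
  exists2 N, J N &
    forall i, ~ N i -> (fun j => repr (rclass (a j)) i) = (fun j => a j i).
Proof.
suff [N JN NA] : exists2 N, J N & forall i, ~ N i -> forall j : 'I_n,
    repr (rclass (a j)) i = a j i.
  by exists N => // i /NA E; apply/funext.
have /choice[N NP] j : exists N, J N /\ forall i, ~ N i ->
    repr (rclass (a j)) i = a j i.
  by have [N JN NA] := repr_rclass (a j); exists N.
exists (\big[setU/set0]_j N j).
  by apply: big_ind => [||j _]; [exact: ideal_set0|exact: ideal_setU|case: (NP j)].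
move=> i Ni j; apply: (NP j).2 => Nji; apply: Ni.
by rewrite (bigD1 j) //=; left.
Qed.

Lemma rprod_funE f (a : 'I_(farity f) -> dprod) :
  rprod_fun (fun j => rclass (a j)) =
  rclass (fun i => fun_interp (fun j => a j i)).
Proof.
have [N JN NA] := repr_rclass_tuple a.
by apply/rclassP; exists N => // i /NA ->.
Qed.

Lemma rprod_relE r (a : 'I_(rarity r) -> dprod) :
  rprod_rel (fun j => rclass (a j)) <->
  J [set i | ~ rel_interp (fun j => a j i)].
Proof.
have [N JN NA] := repr_rclass_tuple a.
by split=> Ja; apply: ideal_sub (ideal_setU JN Ja) => i /= nr;
  have [|/NA E] := pselect (N i); [left|right; move: nr; rewrite /= E|left|
  right; move: nr; rewrite /= E].
Qed.

Lemma supp_eqE (a b : dprod) :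
  supp_eq (rclass a) (rclass b) = pclass J [set i | a i = b i].
Proof.
have [N JN NA] := repr_rclass a; have [N' JN' NB] := repr_rclass b.
apply/pclassP; exists (N `|` N'); first exact: ideal_setU.
by move=> i /not_orP[ni ni'] /=; rewrite NA // NB.
Qed.

End ReducedProduct.

(* Definability without parameters. *)
Definition definable (L : language) (N : structure L) n
    (D : ('I_n -> N) -> Prop) : Prop :=
  exists phi : formula L n, forall v, sat phi v <-> D v.

Definition lpart (A : Type) m n (v : 'I_(m + n) -> A) : 'I_m -> A :=
  fun i => v (lshift n i).
Definition rpart (A : Type) m n (v : 'I_(m + n) -> A) : 'I_n -> A :=
  fun i => v (rshift m i).

(* The Boolean algebra P(X)/J together with the function supp_= is interpreted
   in the reduced product on k-tuples: pi maps the definable set D of k-tuples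
   onto P(X)/J, and the pullbacks along pi of equality, of the Boolean
   operations, and of the graph of supp_= are definable. *)
Definition supp_interpretable (L : language) (X : Type) (J : ideal X)
    (M : X -> structure L) : Prop :=
  let N := reduced_product J M in
  exists (k : nat) (D : ('I_k -> N) -> Prop) (pi : ('I_k -> N) -> powerset_mod J),
    (forall b, exists2 z, D z & pi z = b) /\
    [/\ definable D,
        definable (fun v : 'I_(k + k) -> N =>
          [/\ D (lpart v), D (rpart v) & pi (lpart v) = pi (rpart v)]),
        definable (fun v : 'I_k -> N => D v /\ pi v = \bot%O) &
        definable (fun v : 'I_k -> N => D v /\ pi v = \top%O)] /\
    [/\ definable (fun v : 'I_(k + k) -> N =>
          [/\ D (lpart v), D (rpart v) & pi (rpart v) = (~` pi (lpart v))%O]),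
        definable (fun v : 'I_(k + k + k) -> N =>
          [/\ D (lpart (lpart v)), D (rpart (lpart v)), D (rpart v) &
              pi (rpart v) = (pi (lpart (lpart v)) `&` pi (rpart (lpart v)))%O]),
        definable (fun v : 'I_(k + k + k) -> N =>
          [/\ D (lpart (lpart v)), D (rpart (lpart v)), D (rpart v) &
              pi (rpart v) = (pi (lpart (lpart v)) `|` pi (rpart (lpart v)))%O]) &
        definable (fun v : 'I_(2 + k) -> N =>
          D (rpart v) /\
          pi (rpart v) =
            supp_eq (lpart v (@Ordinal 2 0 isT)) (lpart v (@Ordinal 2 1 isT)))].

(* Main.v *)
(* Los's theorem holds for h-formulas in every reduced product. Hence an
   h-formula equivalent to [x = x' -> y = y'] defines the order
   [supp_= (x, x') <= supp_= (y, y')], and the Boolean algebra with supp_= is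
   interpreted on pairs, a pair naming its own support.

   Conversely, in an atomless reduced product the type of a tuple is determined
   by the h-formulas that it satisfies. If no h-formula is equivalent to
   [x = x' -> y = y'], pick for each h-formula a counterexample to the
   equivalence: to [phi -> (x = x' -> y = y')] if [phi] is a consequence of
   [x = x' -> y = y'], and to the converse otherwise. In a suitable atomless
   reduced product of these counterexamples, two 4-tuples satisfy the same
   h-formulas, namely the consequences of [x = x' -> y = y'], but only one
   satisfies [supp_= (x, x') <= supp_= (y, y')]. So this relation is not
   definable, and supp_= is not interpretable. *)
Require Import Defs.
From mathcomp Require Import all_boot all_order.
From mathcomp Require Import boolp classical_sets.

Set Implicit Arguments.
Unset Strict Implicit.
Unset Printing Implicit Defensive.

Import Order.CTheory.

Local Open Scope classical_set_scope.
Local Open Scope quotient_scope.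

(** Coordinatewise choices need a dependent form of choice, because the factors of a product have
    different carriers. *)
Lemma dep_choice (T : Type) (U : T -> Type) (P : forall x, U x -> Prop) :
  (forall x, exists y, P x y) -> exists f : forall x, U x, forall x, P x (f x).
Proof. by move=> H; exists (fun x => sval (cid (H x))) => x; apply: svalP. Qed.

(** * Valuations: extension by one value and concatenation *)

Section Valuations.
Variable A : Type.

Lemma vext_last n (v : 'I_n -> A) x : vext v x ord_max = x.
Proof. by rewrite /vext unlift_none. Qed.

Lemma vext_lift n (v : 'I_n -> A) x i : vext v x (lift ord_max i) = v i.
Proof. by rewrite /vext liftK. Qed.

Lemma vext_split n (v : 'I_n.+1 -> A) :
  v = vext (fun i => v (lift ord_max i)) (v ord_max).
Proof.
by apply/funext => i; case: (unliftP ord_max i) => [j|] ->;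
  rewrite ?vext_lift ?vext_last.
Qed.

Lemma vext_map B (f : A -> B) n (v : 'I_n -> A) x i :
  f (vext v x i) = vext (fun j => f (v j)) (f x) i.
Proof. by rewrite /vext; case: unlift. Qed.

Definition vcat m n (v : 'I_m -> A) (w : 'I_n -> A) (i : 'I_(m + n)) : A :=
  match split i with inl j => v j | inr j => w j end.

Lemma vcat_lshift m n (v : 'I_m -> A) (w : 'I_n -> A) i :
  vcat v w (lshift n i) = v i.
Proof. by rewrite /vcat -[lshift n i]/(unsplit (inl i)) unsplitK. Qed.

Lemma vcat_rshift m n (v : 'I_m -> A) (w : 'I_n -> A) i :
  vcat v w (rshift m i) = w i.
Proof. by rewrite /vcat -[rshift m i]/(unsplit (inr i)) unsplitK. Qed.

End Valuations.

(** * Renaming of variables, universal closure and finite conjunctions *)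

Section Syntax.
Variable L : language.

Fixpoint tren n m (r : 'I_n -> 'I_m) (t : term L n) : term L m :=
  match t with
  | Var i => Var (r i)
  | App f ts => App (fun j => tren r (ts j))
  end.

(** A quantifier binds the last variable, so under a binder the last variable must go to the last
    one. *)
Definition ren_lift n m (r : 'I_n -> 'I_m) : 'I_n.+1 -> 'I_m.+1 :=
  vext (fun i => lift ord_max (r i)) ord_max.

Fixpoint fren n (phi : formula L n) : forall m, ('I_n -> 'I_m) -> formula L m :=
  match phi with
  | Eq _ s t => fun m r => Eq (tren r s) (tren r t)
  | Rel _ R ts => fun m r => Rel (fun j => tren r (ts j))
  | Not _ p => fun m r => Not (fren p r)
  | And _ p q => fun m r => And (fren p r) (fren q r)
  | Or _ p q => fun m r => Or (fren p r) (fren q r)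
  | Imp _ p q => fun m r => Imp (fren p r) (fren q r)
  | Ex _ p => fun m r => Ex (fren p (ren_lift r))
  | All _ p => fun m r => All (fren p (ren_lift r))
  end.

Fixpoint univ_closure n : formula L n -> sentence L :=
  match n with
  | 0 => id
  | n'.+1 => fun phi => univ_closure (All phi)
  end.

(** Truth as an h-formula; the quantifier supplies a variable even when [n] is 0. *)
Definition ftrue n : formula L n :=
  All (Eq (Var ord_max) (Var ord_max)).

Definition fconj n (I : finType) (F : I -> formula L n) (S : {set I}) :=
  foldr (fun i p => And (F i) p) (ftrue n) (enum S).

Lemma h_formula_true n : h_formula (ftrue n).
Proof. by do !constructor. Qed.

Lemma h_formula_conj n (I : finType) (F : I -> formula L n) S :
  (forall i, h_formula (F i)) -> h_formula (fconj F S).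
Proof.
move=> hF; rewrite /fconj; elim: (enum _) => [|i s IH] /=.
  exact: h_formula_true.
exact: h_And.
Qed.

Variable M : structure L.

Lemma eval_ren n m (r : 'I_n -> 'I_m) (v : 'I_m -> M) (t : term L n) :
  eval v (tren r t) = eval (fun i => v (r i)) t.
Proof. by elim: t => //= f ts IH; congr fun_interp; apply/funext. Qed.

Lemma vext_ren n m (r : 'I_n -> 'I_m) (v : 'I_m -> M) x :
  (fun i => vext v x (ren_lift r i)) = vext (fun i => v (r i)) x.
Proof.
by apply/funext => i; rewrite /ren_lift; case: (unliftP ord_max i) => [j|] ->;
  rewrite ?vext_lift ?vext_last ?vext_lift.
Qed.

Lemma sat_ren n (phi : formula L n) : forall m (r : 'I_n -> 'I_m) (v : 'I_m -> M),
  sat (fren phi r) v <-> sat phi (fun i => v (r i)).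
Proof.
elim: phi => {n} /= [n s t|n R ts|n p IH|n p IHp q IHq|n p IHp q IHq|n p IHp q IHq
                    |n p IH|n p IH] m r v.
- by rewrite !eval_ren.
- suff -> : (fun j => eval v (tren r (ts j)))
    = (fun j => eval (fun i => v (r i)) (ts j)) by [].
  by apply/funext => j; rewrite eval_ren.
- by rewrite IH.
- by rewrite IHp IHq.
- by rewrite IHp IHq.
- by rewrite IHp IHq.
- by split=> -[x]; [rewrite IH vext_ren|rewrite -vext_ren -IH]; exists x.
- by split=> H x; [rewrite -vext_ren -IH|rewrite IH vext_ren].
Qed.

Lemma models_univ_closure n (phi : formula L n) :
  models M (univ_closure phi) <-> forall v : 'I_n -> M, sat phi v.
Proof.
elim: n phi => [//|n IH] phi /=; rewrite IH; split=> H v.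
  by rewrite [v]vext_split; apply: H.
by move=> x; apply: H.
Qed.

Lemma sat_true n (v : 'I_n -> M) : sat (ftrue n) v.
Proof. by []. Qed.

Lemma sat_conj n (I : finType) (F : I -> formula L n) S (v : 'I_n -> M) :
  sat (fconj F S) v <-> forall i, i \in S -> sat (F i) v.
Proof.
suff: sat (fconj F S) v <-> forall i, i \in enum S -> sat (F i) v.
  by move=> ->; split=> H i; have := H i; rewrite mem_enum.
rewrite /fconj; elim: (enum _) => [|i s IH] /=; first by split.
rewrite IH; split=> [[Fi Fs] j|Fs].
  by rewrite in_cons => /orP[/eqP->|/Fs].
by split=> [|j js]; apply: Fs; rewrite in_cons ?eqxx ?js ?orbT.
Qed.

End Syntax.

(** * Closure properties of definable relations *)

Section Definability.
Variables (L : language) (N : structure L).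
Implicit Types n k : nat.

Lemma definable_iff n (D E : ('I_n -> N) -> Prop) :
  (forall v, D v <-> E v) -> definable D -> definable E.
Proof. by move=> DE [phi phiD]; exists phi => v; rewrite phiD. Qed.

Lemma definable_True n : definable (fun _ : 'I_n -> N => True).
Proof. by exists (ftrue L n). Qed.

Lemma definable_and n (D E : ('I_n -> N) -> Prop) :
  definable D -> definable E -> definable (fun v => D v /\ E v).
Proof. by move=> [p Dp] [q Eq]; exists (And p q) => v /=; rewrite Dp Eq. Qed.

Lemma definable_imp n (D E : ('I_n -> N) -> Prop) :
  definable D -> definable E -> definable (fun v => D v -> E v).
Proof. by move=> [p Dp] [q Eq]; exists (Imp p q) => v /=; rewrite Dp Eq. Qed.

Lemma definable_not n (D : ('I_n -> N) -> Prop) :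
  definable D -> definable (fun v => ~ D v).
Proof. by move=> [p Dp]; exists (Not p) => v /=; rewrite Dp. Qed.

Lemma definable_ren n m (D : ('I_n -> N) -> Prop) (r : 'I_n -> 'I_m) :
  definable D -> definable (fun v : 'I_m -> N => D (fun i => v (r i))).
Proof. by move=> [p Dp]; exists (fren p r) => v; rewrite sat_ren Dp. Qed.

(** This is the working form of renaming: a definable relation between two tuples may be applied to
    any, possibly overlapping, selections of variables. *)
Lemma definable_ren2 n1 n2 m (D : ('I_n1 -> N) -> ('I_n2 -> N) -> Prop)
    (f : 'I_n1 -> 'I_m) (g : 'I_n2 -> 'I_m) :
  definable (fun v : 'I_(n1 + n2) -> N => D (lpart v) (rpart v)) ->
  definable (fun v : 'I_m -> N => D (fun i => v (f i)) (fun i => v (g i))).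
Proof.
move/(definable_ren (vcat f g)); apply: definable_iff => v; rewrite /lpart /rpart.
rewrite (_ : (fun i => v (_ (lshift _ i))) = fun i => v (f i)); last first.
  by apply/funext => i; rewrite vcat_lshift.
rewrite (_ : (fun i => v (_ (rshift _ i))) = fun i => v (g i)) //.
by apply/funext => i; rewrite vcat_rshift.
Qed.

Lemma definable_ex n (D : ('I_n -> N) -> N -> Prop) :
  definable (fun v : 'I_n.+1 -> N => D (fun i => v (lift ord_max i)) (v ord_max)) ->
  definable (fun v => exists x, D v x).
Proof.
move=> [p Dp]; exists (Ex p) => v /=.
have E x : (fun i => vext v x (lift ord_max i)) = v.
  by apply/funext => i; rewrite vext_lift.
by split=> -[x Hx]; exists x; move: Hx; rewrite Dp vext_last E.
Qed.

Lemma definable_ex_tuple n k (D : ('I_n -> N) -> ('I_k -> N) -> Prop) :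
  definable (fun v : 'I_(n + k) -> N => D (lpart v) (rpart v)) ->
  definable (fun v => exists z, D v z).
Proof.
elim: k n D => [|k IH] n D defD.
  have z0 (z z' : 'I_0 -> N) : z = z' by apply/funext; case.
  have := definable_ren2 (fun i => i) (fun i : 'I_0 => False_rect 'I_n (notF (ltn_ord i))) defD.
  apply: definable_iff => v; split=> [|[z Dz]]; first by eexists; eassumption.
  by rewrite [X in D _ X](z0 _ z).
(* The last coordinate of the quantified tuple becomes a parameter, which a single quantifier binds
   at the end. *)
pose D' w (z : 'I_k -> N) := D (fun i : 'I_n => w (lift ord_max i)) (vext z (w ord_max)).
have defD' : definable (fun v : 'I_(n.+1 + k) -> N => D' (lpart v) (rpart v)).
  have := definable_ren2 (fun i => lshift k (lift ord_max i))
    (vext (@rshift n.+1 k) (lshift k ord_max)) defD.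
  apply: definable_iff => v; rewrite /D' /lpart /rpart.
  suff -> : (fun i => v (vext (@rshift n.+1 k) (lshift k ord_max) i)) =
    vext (fun i => v (rshift n.+1 i)) (v (lshift k ord_max)) by [].
  by apply/funext => i; rewrite (vext_map v).
apply: (@definable_iff _ (fun v => exists x, exists z, D v (vext z x))).
  move=> v; split=> [[x [z Dxz]]|[z Dz]]; first by eexists; eassumption.
  by exists (z ord_max), (fun i => z (lift ord_max i)); rewrite -vext_split.
by apply: definable_ex; apply: IH defD'.
Qed.

Lemma definable_all_tuple n k (D : ('I_n -> N) -> ('I_k -> N) -> Prop) :
  definable (fun v : 'I_(n + k) -> N => D (lpart v) (rpart v)) ->
  definable (fun v => forall z, D v z).
Proof.
move/definable_not => nD.
have := definable_not (@definable_ex_tuple _ _ (fun v z => ~ D v z) nD).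
apply: definable_iff => v; split=> [H z|H [z]]; last by apply.
by apply: contrapT => nDz; apply: H; exists z.
Qed.

End Definability.

(** * The dual filter, and splitting of non-null sets in the atomless case *)

Section AlmostEverywhere.
Variables (X : Type) (J : ideal X).

Definition ae (P : X -> Prop) : Prop := J [set i | ~ P i].

Lemma ae_mono (P Q : X -> Prop) : (forall i, P i -> Q i) -> ae P -> ae Q.
Proof. by move=> PQ; apply: ideal_sub => i nQ /PQ. Qed.

Lemma ae_iff (P Q : X -> Prop) : (forall i, P i <-> Q i) -> ae P <-> ae Q.
Proof. by move=> PQ; split; apply: ae_mono => i /PQ. Qed.

Lemma ae_and (P Q : X -> Prop) : ae (fun i => P i /\ Q i) <-> ae P /\ ae Q.
Proof.
split=> [PQ|[aeP aeQ]]; first by split; apply: ae_mono PQ => i [].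
by apply: ideal_sub (ideal_setU aeP aeQ) => i /not_andP.
Qed.

Lemma ae_all (P : X -> Prop) : (forall i, P i) -> ae P.
Proof. by move=> PT; apply: ideal_sub (ideal_set0 J) => i /(_ (PT i)). Qed.

Lemma pclass_eq0 A : pclass J A = \bot%O <-> J A.
Proof.
split=> [/pclassP[K JK KA]|JA]; last by apply/pclassP; exists A.
by apply: ideal_sub JK => i Ai; apply: contrapT => /KA[/(_ Ai)].
Qed.

Lemma atomless_split (U : set X) : atomless (powerset_mod J) -> ~ J U ->
  exists V, [/\ V `<=` U, ~ J V & ~ J (U `\` V)].
Proof.
move=> atl nU; apply: contrapT => noV; apply: (atl (pclass J U)); split.
  by rewrite lt0x; apply/eqP => /pclass_eq0.
elim/pclass_ind => W; rewrite lt_neqAle => /andP[/eqP neq /ple_pclass WU].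
(* [W] is contained in [U] only modulo [J], so the candidate for a splitting is [W] cut down to
   [U]. *)
apply/pclass_eq0; apply: contrapT => nW; apply: noV; exists (W `&` U); split.
- by move=> i [].
- move=> JWU; apply: nW; apply: ideal_sub (ideal_setU WU JWU) => i Wi.
  by have [Ui|nUi] := pselect (U i); [right|left].
- move=> JUW; apply: neq; apply/pclassP.
  exists ((W `\` U) `|` (U `\` (W `&` U))); first exact: ideal_setU.
  move=> i /not_orP[nWU nUW]; split=> [Wi|Ui]; apply: contrapT => nn.
    by apply: nWU.
  by apply: nUW; split=> // -[].
Qed.

(** Induction on [s]: split the current [V] into two non-null halves. Removing one of them leaves a
    non-null part of the new set [S i], since otherwise [S i] would be null; keep that half.
    Shrinking [V] does no harm to the earlier sets. *)
Lemma atomless_refine (I : eqType) (s : seq I) (S : I -> set X) (U : set X) :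
  atomless (powerset_mod J) -> ~ J U -> (forall i, i \in s -> ~ J (S i)) ->
  exists V, [/\ V `<=` U, ~ J V & forall i, i \in s -> ~ J (S i `\` V)].
Proof.
move=> atl nU; elim: s => [|i s IH] nS; first by exists U; split.
have [j js|V [VU nV SV]] := IH; first by apply: nS; rewrite in_cons js orbT.
have [W [WV nW nVW]] := atomless_split atl nV.
have [Si|nSi] := pselect (J (S i `\` W)); last first.
  exists W; split=> // [x /WV/VU //|j]; rewrite in_cons => /orP[/eqP->//|/SV nj Jj].
  by apply: nj; apply: ideal_sub Jj => x [Sx nVx]; split=> // /WV.
exists (V `\` W); split=> // [x [/VU] //|j]; rewrite in_cons => /orP[/eqP->|/SV nj] Jj.
  apply: (nS i); first by rewrite in_cons eqxx.
  apply: ideal_sub (ideal_setU Si Jj) => x Sx.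
  by have [Wx|nWx] := pselect (W x); [right; split=> // -[]|left].
by apply: nj; apply: ideal_sub Jj => x [Sx nVx]; split=> // -[].
Qed.

End AlmostEverywhere.

(** * Satisfaction of h-formulas in reduced products *)

Section ReducedProductHFormulas.
Variables (L : language) (X : Type) (J : ideal X) (M : X -> structure L).
Let N := reduced_product J M.
Implicit Types a b c : dprod M.

Lemma rclass_repr (x : N) : exists a, rclass J a = x.
Proof. by exists (repr (x : rprod_carrier J M)); apply: reprK. Qed.

Lemma rclass_repr_tuple n (v : 'I_n -> N) :
  exists a : 'I_n -> dprod M, v = fun j => rclass J (a j).
Proof.
exists (fun j => repr (v j : rprod_carrier J M)).
by apply/funext => j; rewrite /rclass reprK.
Qed.

Definition coord n (a : 'I_n -> dprod M) i : 'I_n -> M i := fun j => a j i.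

Lemma vext_rclass n (a : 'I_n -> dprod M) b :
  vext (fun j => rclass J (a j)) (rclass J b) = fun j => rclass J (vext a b j).
Proof. by apply/funext => j; rewrite (vext_map (@rclass L X J M)). Qed.

Lemma coord_vext n (a : 'I_n -> dprod M) b i :
  coord (vext a b) i = vext (coord a i) (b i).
Proof. by apply/funext => j; rewrite /coord (vext_map (fun c : dprod M => c i)). Qed.

Lemma eval_rprod n (a : 'I_n -> dprod M) (t : term L n) :
  eval (fun j => rclass J (a j) : N) t = rclass J (fun i => eval (coord a i) t).
Proof.
elim: t => [//|f ts IH] /=.
by rewrite -(rprod_funE J (fun j i => eval (coord a i) (ts j)));
  congr rprod_fun; apply/funext.
Qed.

Lemma rclass_eq a b : rclass J a = rclass J b <-> ae J (fun i => a i = b i).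
Proof.
rewrite rclassP; split=> [[K JK Kab]|Jab].
  by apply: ideal_sub JK => i ab; apply: contrapT => /Kab.
by exists [set i | a i <> b i] => // i /contrapT.
Qed.

(* The analogue of Los's theorem; it fails for arbitrary formulas because a set
   and its complement may both be outside the ideal. *)
Lemma sat_h_formula n (phi : formula L n) : h_formula phi ->
  forall a : 'I_n -> dprod M,
  sat phi (fun j => rclass J (a j) : N) <-> ae J (fun i => sat phi (coord a i)).
Proof.
(* Witnesses are chosen coordinate by coordinate, with an arbitrary value where none exists. *)
have exP m (p : formula L m.+1) :
    forall a : 'I_m -> dprod M, ae J (fun i => exists x, sat p (vext (coord a i) x)) ->
    exists b, ae J (fun i => sat p (vext (coord a i) (b i))).
  move=> a aep.
  have /dep_choice[b bP] : forall i, exists x : M i,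
      (exists x, sat p (vext (coord a i) x)) -> sat p (vext (coord a i) x).
    move=> i; have [[x px]|np] := pselect (exists x, sat p (vext (coord a i) x)).
      by exists x.
    by case: (carrier_inh (M i)) => x; exists x => /np.
  by exists b; apply: ae_mono aep.
elim=> {n phi} [n s t|n r ts|n p q _ IHp _ IHq|n p _ IHp|n p _ IHp|n p q _ IHp _ IHq] a /=.
- by rewrite !eval_rprod rclass_eq.
- suff -> : (fun j => eval (fun k => rclass J (a k) : N) (ts j)) =
      (fun j => rclass J (fun i => eval (coord a i) (ts j))) by apply: rprod_relE.
  by apply/funext => j; rewrite eval_rprod.
- by rewrite IHp IHq ae_and.
- split=> [[x]|/exP[b pb]].
    have [b <-] := rclass_repr x; rewrite vext_rclass IHp; apply: ae_mono => i.
    by rewrite coord_vext; exists (b i).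
  exists (rclass J b); rewrite vext_rclass IHp; apply: ae_mono pb => i.
  by rewrite coord_vext.
- split=> [H|H x]; last first.
    have [b <-] := rclass_repr x; rewrite vext_rclass IHp; apply: ae_mono H => i.
    by rewrite coord_vext; apply.
  (* Take a counterexample to [p] wherever there is one: this single [b] tests the universal formula
     at every coordinate. *)
  have /dep_choice[b bP] : forall i, exists x : M i,
      sat p (vext (coord a i) x) -> forall x, sat p (vext (coord a i) x).
    move=> i; have [H'|/existsNP[x nx]] := pselect (forall x, sat p (vext (coord a i) x)).
      by case: (carrier_inh (M i)) => x; exists x.
    by exists x => /nx.
  have := H (rclass J b); rewrite vext_rclass IHp; apply: ae_mono => i.
  by rewrite coord_vext; apply: bP.
- rewrite ae_and; split=> [[[x]]|[/exP[b pb] pq]].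
    have [b <-] := rclass_repr x; rewrite vext_rclass IHp => pb pq.
    split; first by apply: ae_mono pb => i; rewrite coord_vext; exists (b i).
    (* Wherever the implication fails, replace the witness of [p] by a
       counterexample. *)
    have /dep_choice[c cP] : forall i, exists x : M i,
        (sat p (vext (coord a i) (b i)) -> sat p (vext (coord a i) x)) /\
        (sat q (vext (coord a i) x) ->
         forall x, sat p (vext (coord a i) x) -> sat q (vext (coord a i) x)).
      move=> i; have [H|] := pselect (forall x, sat p (vext (coord a i) x) ->
         sat q (vext (coord a i) x)); first by exists (b i).
      by move=> /existsNP[y /not_implyP[py nqy]]; exists y; split=> // /nqy.
    have := pq (rclass J c); rewrite vext_rclass IHp IHq => pqc.
    suff /pqc : ae J (fun i => sat p (coord (vext a c) i)).
      by apply: ae_mono => i; rewrite coord_vext; apply: (cP i).2.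
    by apply: ae_mono pb => i; rewrite !coord_vext; apply: (cP i).1.
  split=> [|x].
    by exists (rclass J b); rewrite vext_rclass IHp; apply: ae_mono pb => i;
      rewrite coord_vext.
  have [c <-] := rclass_repr x; rewrite vext_rclass IHp IHq => pc.
  have /ae_and := conj pq pc; apply: ae_mono => i [].
  by rewrite coord_vext; apply.
Qed.

Lemma supp_eq_le a0 a1 a2 a3 :
  (supp_eq (rclass J a0) (rclass J a1) <= supp_eq (rclass J a2) (rclass J a3))%O <->
  ae J (fun i => a0 i = a1 i -> a2 i = a3 i).
Proof.
rewrite !supp_eqE ple_pclass /ae; suff -> : [set i | a0 i = a1 i] `\` [set i | a2 i = a3 i] =
  [set i | ~ (a0 i = a1 i -> a2 i = a3 i)] by [].
by apply/seteqP; split=> i /= => [[e ne /(_ e)]|/not_implyP].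
Qed.

(** * Quantifier elimination in atomless reduced products *)

Section Atomless.
Hypothesis atl : atomless (powerset_mod J).

(** Induction on [s]: [x] refutes the earlier formulas and [y] the new one. Use [y] on a non-null
    set [V] where it fails the new formula, and [x] elsewhere; [V] is chosen so small that every
    earlier failure of [x] stays non-null outside it. Almost everywhere, [p] holds for both and
    hence for the mixture. *)
Lemma atomless_glue n (I : eqType) (s : seq I) (p : formula L n.+1)
    (q : I -> formula L n.+1) (v : 'I_n -> N) :
  h_formula p -> (forall i, h_formula (q i)) ->
  (exists x, sat p (vext v x)) ->
  (forall i, i \in s -> exists x, sat p (vext v x) /\ ~ sat (q i) (vext v x)) ->
  exists x, sat p (vext v x) /\ forall i, i \in s -> ~ sat (q i) (vext v x).
Proof.
move=> hp hq; have [a {v}->] := rclass_repr_tuple v.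
elim: s => [[x px] _|j s IH exp exq]; first by exists x.
have [i si|x [px nqx]] := IH exp; first by apply: exq; rewrite in_cons si orbT.
have [|y [py nqy]] := exq j; first by rewrite in_cons eqxx.
have [c xc] := rclass_repr x; have [d yd] := rclass_repr y.
move: px nqx py nqy; rewrite -{}xc -{}yd !vext_rclass !sat_h_formula // => pc nqc pd nqd.
have [|V [VU nV SV]] := @atomless_refine _ J _ s
    (fun i => [set k | ~ sat (q i) (coord (vext a c) k)]) _ atl nqd.
  by move=> i /nqc; rewrite sat_h_formula.
pose e k := if pselect (V k) then d k else c k.
have eV k : V k -> e k = d k by rewrite /e; case: pselect.
have enV k : ~ V k -> e k = c k by rewrite /e; case: pselect.
exists (rclass J e); rewrite vext_rclass sat_h_formula //; split.
  have /ae_and := conj pc pd; apply: ae_mono => k [].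
  by rewrite !coord_vext /e; case: pselect.
move=> i; rewrite in_cons sat_h_formula // => /orP[/eqP->|/SV nS] Je.
  by apply: nV; apply: ideal_sub Je => k Vk; have := VU _ Vk; rewrite /= !coord_vext eV.
by apply: nS; apply: ideal_sub Je => k [] /=; rewrite !coord_vext => H /enV ->.
Qed.

(* Elimination of quantifiers down to Boolean combinations of h-formulas: by
   glueing, [exists x, p /\ ~ q_1 /\ ... /\ ~ q_m] reduces to the
   [exists x, p /\ ~ q_i], that is, to the negations of
   [(exists x, p) /\ forall x, p -> q_i]. *)
Lemma atomless_h_determined n (psi : formula L n) :
  exists (I : finType) (F : I -> formula L n), (forall i, h_formula (F i)) /\
  forall v w : 'I_n -> N, (forall i, sat (F i) v <-> sat (F i) w) ->
  (sat psi v <-> sat psi w).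
Proof.
have bin m (p q r : formula L m) :
    (forall v w : 'I_m -> N, (sat p v <-> sat p w) -> (sat q v <-> sat q w) ->
      (sat r v <-> sat r w)) ->
    (exists (I : finType) (F : I -> formula L m), (forall i, h_formula (F i)) /\
      forall v w : 'I_m -> N, (forall i, sat (F i) v <-> sat (F i) w) ->
      (sat p v <-> sat p w)) ->
    (exists (I : finType) (F : I -> formula L m), (forall i, h_formula (F i)) /\
      forall v w : 'I_m -> N, (forall i, sat (F i) v <-> sat (F i) w) ->
      (sat q v <-> sat q w)) ->
    exists (I : finType) (F : I -> formula L m), (forall i, h_formula (F i)) /\
      forall v w : 'I_m -> N, (forall i, sat (F i) v <-> sat (F i) w) ->
      (sat r v <-> sat r w).
  move=> pqr [I [F [hF FP]]] [I' [F' [hF' FP']]].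
  exists (I + I')%type, (fun i => match i with inl i => F i | inr i => F' i end).
  split=> [[]//|v w vw]; apply: pqr; [apply: FP => i|apply: FP' => i].
    exact: vw (inl i).
  exact: vw (inr i).
(* The conclusion has back-and-forth form, so that it serves both quantifiers. *)
have quant m (p : formula L m.+1) :
    (exists (I : finType) (F : I -> formula L m.+1), (forall i, h_formula (F i)) /\
      forall v w : 'I_m.+1 -> N, (forall i, sat (F i) v <-> sat (F i) w) ->
      (sat p v <-> sat p w)) ->
    exists (I : finType) (F : I -> formula L m), (forall i, h_formula (F i)) /\
      forall v w : 'I_m -> N, (forall i, sat (F i) v <-> sat (F i) w) ->
      forall x, exists y, sat p (vext v x) <-> sat p (vext w y).
  move=> [I [F [hF FP]]].
  (* The index [(S, None)] says that the conjunction over [S] is satisfiable; given this, the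
     failure of [(S, Some i)] says that it is satisfiable together with the negation of [F i]. *)
  exists ({set I} * option I)%type, (fun u =>
    let c := fconj F u.1 in
    if u.2 is Some i then And (Ex c) (All (Imp c (F i))) else Ex c).
  split=> [[S [i|]]/=|v w vw x].
  - by apply: h_ExAll => //; apply: h_formula_conj.
  - by apply: h_Ex; apply: h_formula_conj.
  (* [S] records the [F i] true of [x] over [v]. Glueing over [w] yields a [y] that satisfies these
     and refutes all the others. *)
  pose S := [set i | `[< sat (F i) (vext v x) >]]%SET.
  have Sx : sat (fconj F S) (vext v x).
    by apply/sat_conj => i; rewrite inE => /asboolP.
  have [|||i|y [/sat_conj Sy nSy]] := @atomless_glue _ _ (enum (~: S)) (fconj F S) F w.
  - exact: h_formula_conj.
  - exact: hF.
  - by apply/(vw (S, None)); exists x.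
  - rewrite mem_enum !inE => /asboolP nFi; apply: contrapT => noy.
    have /= [_ [|_ /(_ x Sx)//]] := vw (S, Some i).
    split=> [|y Sy]; first by apply/(vw (S, None)); exists x.
    by apply: contrapT => nFy; apply: noy; exists y.
  exists y; apply: FP => i; have [Fi|nFi] := pselect (sat (F i) (vext v x)).
    by split=> // _; apply: Sy; rewrite inE; apply/asboolP.
  split=> // Fi; case: (nSy i) => //.
  by rewrite mem_enum !inE; apply/asboolP.
elim: psi => {n} [n s t|n r ts|n p IH|n p IHp q IHq|n p IHp q IHq|n p IHp q IHq
                 |n p /quant IH|n p /quant IH].
- exists unit, (fun=> Eq s t); split=> [_|v w /(_ tt) //]; exact: h_Eq.
- exists unit, (fun=> Rel ts); split=> [_|v w /(_ tt) //]; exact: h_Rel.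
- by have [I [F [hF FP]]] := IH; exists I, F; split=> // v w /FP /= ->.
- by apply: bin IHp IHq => v w /= -> ->.
- by apply: bin IHp IHq => v w /= -> ->.
- by apply: bin IHp IHq => v w /= -> ->.
- have [I [F [hF FP]]] := IH; exists I, F; split=> // v w vw /=.
  split=> -[x px]; first by have [y yP] := FP v w vw x; exists y; apply/yP.
  by have [|y yP] := FP w v _ x; [move=> i; rewrite vw|exists y; apply/yP].
- have [I [F [hF FP]]] := IH; exists I, F; split=> // v w vw /=.
  split=> H x; last by have [y ->] := FP v w vw x.
  by have [|y ->] := FP w v _ x; first by move=> i; rewrite vw.
Qed.

End Atomless.
End ReducedProductHFormulas.

(** * Interpretability of the support function and definability of the order of supports *)

Section SupportInterpretation.
Variables (L : language) (X : Type) (J : ideal X) (M : X -> structure L).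
Let N := reduced_product J M.

Definition supp2 (z : 'I_2 -> N) : powerset_mod J :=
  supp_eq (z (@Ordinal 2 0 isT)) (z (@Ordinal 2 1 isT)).

Definition supp_le_definable : Prop :=
  definable (fun v : 'I_(2 + 2) -> N => (supp2 (lpart v) <= supp2 (rpart v))%O).

Lemma supp_le_eq_imp_eq (a : 'I_4 -> dprod M) :
  let v j : N := rclass J (a j) in
  (supp2 (@lpart _ 2 2 v) <= supp2 (@rpart _ 2 2 v))%O <->
  ae J (fun i => sat (eq_imp_eq L) (coord a i)).
Proof.
rewrite /= /supp2 /lpart /rpart supp_eq_le; apply: ae_iff => i.
by rewrite /coord; split; congr (a _ i = a _ i -> a _ i = a _ i); apply: val_inj.
Qed.

Lemma supp2_surj : (forall i, exists x y : M i, x <> y) ->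
  forall b, exists z, supp2 z = b.
Proof.
move=> two; elim/pclass_ind => A.
have [x /dep_choice[y xy]] := dep_choice two.
(* As [x] and [y] differ everywhere, [x] and [y'] agree exactly on [A]. *)
pose y' i := if pselect (A i) then x i else y i.
exists (fun j : 'I_2 => if val j == 0 then rclass J x else rclass J y').
rewrite /supp2 /= supp_eqE; congr pclass; apply/seteqP; split=> i /=; rewrite /y'.
  by case: pselect => // _ /xy.
by case: pselect.
Qed.

(** The order is recovered from the meet: [b <= c] means that [b] is the meet of [b] and [c]. The
    two supports are named by tuples [z] and [w], and the graph of the meet is evaluated at [z],
    [w], [z]. *)
Lemma supp_interpretable_le : supp_interpretable J M -> supp_le_definable.
Proof.
move=> [k [D [pi [pi_surj [_ [_ defI _ defS]]]]]].
pose G (u : 'I_2 -> N) z := D z /\ pi z = supp2 u.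
pose P (v : 'I_(2 + 2) -> N) z w := [/\ G (lpart v) z, G (rpart v) w &
  D z /\ D w /\ D z /\ pi z = (pi z `&` pi w)%O].
apply: (@definable_iff _ _ _ (fun v => exists z, exists w, P v z w)).
  move=> v; split=> [[z [w [[_ ez] [_ ew] [_ [_ [_]]]]]]|le].
    by rewrite -ez -ew leEmeet => <-.
  have [z Dz ez] := pi_surj (supp2 (lpart v)).
  have [w Dw ew] := pi_surj (supp2 (rpart v)).
  by exists z, w; split=> //; do 3!split=> //; rewrite ez ew; apply/esym/meet_idPl.
apply: definable_ex_tuple; apply: definable_ex_tuple.
have defG m (f : 'I_2 -> 'I_m) (g : 'I_k -> 'I_m) :
    definable (fun v : 'I_m -> N => G (fun i => v (f i)) (fun i => v (g i))).
  exact: (definable_ren2 (D := G) f g defS).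
pose f1 i : 'I_(2 + 2 + k + k) := lshift k (lshift k (lshift 2 i)).
pose f2 i : 'I_(2 + 2 + k + k) := lshift k (lshift k (rshift 2 i)).
pose z i : 'I_(2 + 2 + k + k) := lshift k (rshift (2 + 2) i).
pose w i : 'I_(2 + 2 + k + k) := rshift (2 + 2 + k) i.
pose I3 (u : 'I_(k + k) -> N) t := [/\ D (lpart u), D (rpart u), D t &
  pi t = (pi (lpart u) `&` pi (rpart u))%O].
have defI3 := definable_ren2 (D := I3) (vcat z w) z defI.
have := definable_and (defG _ f1 z) (definable_and (defG _ f2 w) defI3).
apply: definable_iff => v; rewrite /I3 /lpart /rpart.
have -> : (fun i => v (vcat z w (lshift k i))) = fun i => v (z i).
  by apply/funext => i; rewrite vcat_lshift.
have -> : (fun i => v (vcat z w (rshift k i))) = fun i => v (w i).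
  by apply/funext => i; rewrite vcat_rshift.
by split=> [[? [? [? ? ? ?]]]|[? ? [? [? [? ?]]]]].
Qed.

(** All the Boolean operations are first-order definable from the order. Since every element is the
    support of a pair, quantifying over pairs amounts to quantifying over the algebra. *)
Lemma supp_le_interpretable : (forall b, exists z, supp2 z = b) ->
  supp_le_definable -> supp_interpretable J M.
Proof.
move=> surj defle.
have le_ren m (f g : 'I_2 -> 'I_m) : definable (fun v : 'I_m -> N =>
    (supp2 (fun i => v (f i)) <= supp2 (fun i => v (g i)))%O).
  exact: (definable_ren2 (D := fun z w => (supp2 z <= supp2 w)%O) f g defle).
have le0 z : supp2 z = \bot%O <-> forall w, (supp2 z <= supp2 w)%O.
  split=> [-> w|H]; first exact: le0x.
  by apply/eqP; rewrite -lex0; have [w <-] := surj \bot%O.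
have le1 z : supp2 z = \top%O <-> forall w, (supp2 w <= supp2 z)%O.
  split=> [-> w|H]; first exact: lex1.
  by apply/eqP; rewrite -le1x; have [w <-] := surj \top%O.
have leI z w t : supp2 t = (supp2 z `&` supp2 w)%O <->
   (supp2 t <= supp2 z)%O /\ (supp2 t <= supp2 w)%O /\
   forall u, (supp2 u <= supp2 z)%O -> (supp2 u <= supp2 w)%O -> (supp2 u <= supp2 t)%O.
  split=> [->|[tz [tw H]]].
    by rewrite leIl leIr; do 2!split=> //; move=> u; rewrite lexI => -> ->.
  apply/eqP; rewrite eq_le lexI tz tw /=; have [u eu] := surj (supp2 z `&` supp2 w)%O.
  by rewrite -eu; apply: H; rewrite eu ?leIl ?leIr.
have leU z w t : supp2 t = (supp2 z `|` supp2 w)%O <->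
   (supp2 z <= supp2 t)%O /\ (supp2 w <= supp2 t)%O /\
   forall u, (supp2 z <= supp2 u)%O -> (supp2 w <= supp2 u)%O -> (supp2 t <= supp2 u)%O.
  split=> [->|[tz [tw H]]].
    by rewrite leUl leUr; do 2!split=> //; move=> u; rewrite leUx => -> ->.
  apply/eqP; rewrite eq_le leUx tz tw /= andbT; have [u eu] := surj (supp2 z `|` supp2 w)%O.
  by rewrite -eu; apply: H; rewrite eu ?leUl ?leUr.
(* A complement is described by order alone: every common lower bound is least and every common
   upper bound is greatest. *)
have leC z w : supp2 w = (~` supp2 z)%O <->
   (forall u, (supp2 u <= supp2 z)%O -> (supp2 u <= supp2 w)%O ->
      forall t, (supp2 u <= supp2 t)%O) /\
   (forall u, (supp2 z <= supp2 u)%O -> (supp2 w <= supp2 u)%O ->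
      forall t, (supp2 t <= supp2 u)%O).
  split=> [->|[H0 H1]].
    split=> u zu wu t.
      by apply: le_trans (le0x _); rewrite -(meetxC (supp2 z)) lexI zu.
    by apply: le_trans (lex1 _) _; rewrite -(joinxC (supp2 z)) leUx zu.
  have zw0 : (supp2 z `&` supp2 w = \bot)%O.
    have [u eu] := surj (supp2 z `&` supp2 w)%O; rewrite -eu.
    by apply/le0/H0; rewrite eu ?leIl ?leIr.
  have zw1 : (supp2 z `|` supp2 w = \top)%O.
    have [u eu] := surj (supp2 z `|` supp2 w)%O; rewrite -eu.
    by apply/le1/H1; rewrite eu ?leUl ?leUr.
  (* Uniqueness of complements by distributivity: both sides equal the meet of [supp2 w] with the
     complement of [supp2 z]. *)
  rewrite -[LHS]meetx1 -(joinxC (supp2 z)) meetUr [X in (X `|` _)%O]meetC zw0 join0x.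
  by rewrite -[RHS]meetx1 -zw1 meetUr [(_ `&` supp2 z)%O]meetC meetxC join0x meetC.
have defEq m (f g : 'I_2 -> 'I_m) : definable (fun v : 'I_m -> N =>
    supp2 (fun i => v (f i)) = supp2 (fun i => v (g i))).
  apply: definable_iff (definable_and (le_ren _ f g) (le_ren _ g f)) => v.
  by split=> [[H H']|->//]; apply/eqP; rewrite eq_le H H'.
have defI m (f g h : 'I_2 -> 'I_m) : definable (fun v : 'I_m -> N =>
    supp2 (fun i => v (h i)) =
      (supp2 (fun i => v (f i)) `&` supp2 (fun i => v (g i)))%O).
  apply: definable_iff (fun v => iff_sym (leI _ _ _)) _.
  apply: definable_and; first exact: le_ren.
  apply: definable_and; first exact: le_ren.
  apply: definable_all_tuple; apply: definable_imp.
    exact: (le_ren _ (@rshift m 2) (fun i => lshift 2 (f i))).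
  apply: definable_imp.
    exact: (le_ren _ (@rshift m 2) (fun i => lshift 2 (g i))).
  exact: (le_ren _ (@rshift m 2) (fun i => lshift 2 (h i))).
have defU m (f g h : 'I_2 -> 'I_m) : definable (fun v : 'I_m -> N =>
    supp2 (fun i => v (h i)) =
      (supp2 (fun i => v (f i)) `|` supp2 (fun i => v (g i)))%O).
  apply: definable_iff (fun v => iff_sym (leU _ _ _)) _.
  apply: definable_and; first exact: le_ren.
  apply: definable_and; first exact: le_ren.
  apply: definable_all_tuple; apply: definable_imp.
    exact: (le_ren _ (fun i => lshift 2 (f i)) (@rshift m 2)).
  apply: definable_imp.
    exact: (le_ren _ (fun i => lshift 2 (g i)) (@rshift m 2)).
  exact: (le_ren _ (fun i => lshift 2 (h i)) (@rshift m 2)).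
have defC m (f g : 'I_2 -> 'I_m) : definable (fun v : 'I_m -> N =>
    supp2 (fun i => v (g i)) = (~` supp2 (fun i => v (f i)))%O).
  apply: definable_iff (fun v => iff_sym (leC _ _)) _.
  apply: definable_and; apply: definable_all_tuple; apply: definable_imp.
  - exact: (le_ren _ (@rshift m 2) (fun i => lshift 2 (f i))).
  - apply: definable_imp.
      exact: (le_ren _ (@rshift m 2) (fun i => lshift 2 (g i))).
    apply: definable_all_tuple.
    exact: (le_ren _ (fun i => lshift 2 (rshift m i)) (@rshift (m + 2) 2)).
  - exact: (le_ren _ (fun i => lshift 2 (f i)) (@rshift m 2)).
  - apply: definable_imp.
      exact: (le_ren _ (fun i => lshift 2 (g i)) (@rshift m 2)).
    apply: definable_all_tuple.
    exact: (le_ren _ (@rshift (m + 2) 2) (fun i => lshift 2 (rshift m i))).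
exists 2, (fun=> True), supp2; split.
  by move=> b; have [z] := surj b; exists z.
do !split.
- exact: definable_True.
- apply: definable_iff (defEq _ (@lshift 2 2) (@rshift 2 2)) => v.
  by split=> [|[]].
- apply: (@definable_iff _ _ _ (fun z => forall w, (supp2 z <= supp2 w)%O)).
    by move=> z; rewrite -le0; split=> [|[]].
  exact: definable_all_tuple.
- apply: (@definable_iff _ _ _ (fun z => forall w, (supp2 w <= supp2 z)%O)).
    by move=> z; rewrite -le1; split=> [|[]].
  by apply: definable_all_tuple; apply: (le_ren _ (@rshift 2 2) (@lshift 2 2)).
- by apply: definable_iff (defC _ (@lshift 2 2) (@rshift 2 2)) => v; split=> [|[]].
- apply: definable_iff (defI _ (fun i => lshift 2 (lshift 2 i))
    (fun i => lshift 2 (rshift 2 i)) (@rshift (2 + 2) 2)) => v.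
  by split=> [|[]].
- apply: definable_iff (defU _ (fun i => lshift 2 (lshift 2 i))
    (fun i => lshift 2 (rshift 2 i)) (@rshift (2 + 2) 2)) => v.
  by split=> [|[]].
(* The two arguments of the support function form a pair that names the value, so its graph is
   equality of supports. *)
- apply: definable_iff (defEq _ (@rshift 2 2) (@lshift 2 2)) => v.
  by split=> [|[]].
Qed.

End SupportInterpretation.

(** * Infinite sets of naturals, and a criterion for atomlessness *)

Definition unbounded (S : set nat) : Prop := forall m, exists2 n, m <= n & S n.

Lemma not_unbounded S : ~ unbounded S <-> exists m, forall n, m <= n -> ~ S n.
Proof.
split=> [/existsNP[m mS]|[m mS] /(_ m)[n /mS]//].
by exists m => n mn Sn; apply: mS; exists n.
Qed.

(** The parity of the number of elements of [S] below [n]; it alternates along the elements of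
    [S]. *)
Fixpoint parity (S : set nat) n : bool :=
  if n is k.+1 then `[< S k >] (+) parity S k else false.

Lemma unbounded_parity S b : unbounded S -> unbounded [set n | S n /\ parity S n = b].
Proof.
move=> infS; apply: contrapT => /not_unbounded[m mS].
have [n mn Sn] := infS m.
have pn : parity S n = ~~ b.
  have /eqP : parity S n <> b by move=> pn; apply: (mS n mn).
  by case: (parity S n) (b) => -[].
(* Past [n] the parity is [b], and it could change only after another element of [S]; such an
   element would have parity [b] itself, which is excluded beyond [m]. *)
have step k : n < k -> parity S k = b /\ ~ S k.
  elim: k => // k IH; rewrite ltnS leq_eqVlt => /orP nk.
  have pb : parity S k.+1 = b.
    rewrite /=; case: nk => [/eqP<-|/IH[-> nSk]]; last by rewrite asboolF.
    by rewrite asboolT // pn addTb negbK.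
  split=> // Sk; apply: (mS k.+1) => //.
  by case: nk => [/eqP<-|nk]; [apply: leqW|apply: leq_trans mn (leqW (ltnW nk))].
by have [k nk Sk] := infS n.+1; have [_ []] := step k nk.
Qed.

Lemma unbounded_split S : unbounded S ->
  exists T, [/\ T `<=` S, unbounded T & unbounded (S `\` T)].
Proof.
move=> infS; exists [set n | S n /\ parity S n = true]; split.
- by move=> n [].
- exact: unbounded_parity.
- move=> m; have [n mn [Sn pn]] := unbounded_parity false infS m.
  by exists n => //; split=> // -[_]; rewrite pn.
Qed.

Lemma split_atomless (X : Type) (J : ideal X) :
  (forall A, ~ J A -> exists B, [/\ B `<=` A, ~ J B & ~ J (A `\` B)]) ->
  atomless (powerset_mod J).
Proof.
move=> splitJ; elim/pclass_ind => A [A0 Amin].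
have [|B [BA nB nAB]] := splitJ A.
  by move/pclass_eq0 => A00; move: A0; rewrite A00 ltxx.
apply: nB; apply/pclass_eq0/Amin; rewrite lt_neqAle; apply/andP; split.
  by apply/eqP => BA'; apply: nAB; apply/ple_pclass; rewrite BA'.
by apply/ple_pclass; apply: ideal_sub (ideal_set0 J) => x [/BA].
Qed.

(** * The atomless reduced product of counterexamples *)

Section Counterexamples.
Variables (L : language) (C : structure L -> Prop).

Definition hform := {phi : formula L 4 | h_formula phi}.

Definition entails (p q : formula L 4) : Prop :=
  forall M, C M -> forall v : 'I_4 -> M, sat p v -> sat q v.

Definition h_conseq (phi : hform) : Prop := entails (eq_imp_eq L) (sval phi).

Definition h_true : hform := exist _ (ftrue L 4) (h_formula_true L 4).

Definition h_and (phi psi : hform) : hform :=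
  exist _ (And (sval phi) (sval psi)) (h_And (svalP phi) (svalP psi)).

(* Modulo finite sets in each column, the dual filter is generated by the sets
   of those [y] that entail [phi] or are not in [h_conseq], [phi] ranging over
   [h_conseq]; the factor [nat] makes the quotient atomless. *)
Definition h_null (A : set (hform * nat)) : Prop :=
  exists2 phi, h_conseq phi & forall y,
    (h_conseq y /\ ~ entails (sval y) (sval phi)) \/
    exists m, forall n, m <= n -> ~ A (y, n).

Lemma h_null0 : h_null set0.
Proof.
exists h_true => [M _ v _|y]; first exact: sat_true.
by right; exists 0 => n _ [].
Qed.

Lemma h_null_sub A B : A `<=` B -> h_null B -> h_null A.
Proof.
move=> AB [phi phiH Bphi]; exists phi => // y.
case: (Bphi y) => [|[m Bm]]; [by left|right].
by exists m => n mn /AB; apply: Bm.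
Qed.

Lemma h_nullU A B : h_null A -> h_null B -> h_null (A `|` B).
Proof.
move=> [phi phiH Aphi] [psi psiH Bpsi]; exists (h_and phi psi).
  by move=> M CM v tv; split; [apply: phiH tv|apply: psiH tv].
move=> y; case: (Aphi y) => [[yH nphi]|[m Am]].
  by left; split=> // H; apply: nphi => M CM v /(H _ CM)[].
case: (Bpsi y) => [[yH npsi]|[k Bk]].
  by left; split=> // H; apply: npsi => M CM v /(H _ CM)[].
right; exists (maxn m k) => n; rewrite geq_max => /andP[mn kn] [|].
  exact: Am.
exact: Bk.
Qed.

(** The column of [phi] itself is decisive: [phi] entails [phi], so that column would have to be
    finite, yet [A] contains all of it. *)
Lemma h_null_conseq A : (forall y n, h_conseq y -> A (y, n)) -> ~ h_null A.
Proof.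
move=> HA [phi phiH /(_ phi)[[_]|[m]]]; first by apply.
by move=> /(_ m (leqnn m)); apply; apply: HA.
Qed.

Definition h_ideal : ideal (hform * nat) :=
  Ideal h_null0 h_null_sub h_nullU (h_null_conseq (fun _ _ _ => I)).

Lemma h_ideal_column A y : ~ h_conseq y -> (forall n, A (y, n)) -> ~ h_ideal A.
Proof.
move=> ny Ay [phi _ /(_ y)[[]//|[m]]].
by move=> /(_ m (leqnn m)); apply.
Qed.

(** Every infinite column of [A] is cut into two infinite halves. A column of either half is then
    finite only if that column of [A] is, so if one half were null, the same [phi] would show [A]
    null. *)
Lemma h_ideal_atomless : atomless (powerset_mod h_ideal).
Proof.
apply: split_atomless => A nA.
have /choice[T TP] : forall y, exists T : set nat, T `<=` [set n | A (y, n)] /\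
    (unbounded [set n | A (y, n)] ->
       unbounded T /\ unbounded ([set n | A (y, n)] `\` T)).
  move=> y; have [/unbounded_split[T [TA T1 T2]]|nu] :=
    pselect (unbounded [set n | A (y, n)]); first by exists T.
  by exists set0; split=> [n []|/nu].
exists [set x | T x.1 x.2]; split.
- by move=> [y n] /= /(TP y).1.
- move=> [phi phiH TA]; apply: nA; exists phi => // y.
  case: (TA y) => [|/not_unbounded nT]; [by left|right; apply/not_unbounded].
  by move=> /(TP y).2[].
- move=> [phi phiH TA]; apply: nA; exists phi => // y.
  case: (TA y) => [|/not_unbounded nT]; [by left|right; apply/not_unbounded].
  by move=> /(TP y).2[_] H; apply: nT.
Qed.

(** The universal closure of the equivalence belongs to [Th C], which carries it from [C] to all
    models of the theory. *)
Lemma equivalent_in_Th n (p q : formula L n) :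
  (forall M, C M -> forall v : 'I_n -> M, sat p v <-> sat q v) ->
  equivalent_in (Th C) p q.
Proof.
move=> pq N NT v.
have /NT/models_univ_closure/(_ v) [] // : Th C (univ_closure (And (Imp p q) (Imp q p))).
by move=> M CM; apply/models_univ_closure => w; split=> /(pq _ CM).
Qed.

Lemma h_counterexamples :
  ~ (exists2 phi : formula L 4, h_formula phi &
       equivalent_in (Th C) (eq_imp_eq L) phi) ->
  forall y : hform, exists T : {M : structure L & 'I_4 -> M}, [/\ C (projT1 T),
    h_conseq y -> sat (sval y) (projT2 T) /\ ~ sat (eq_imp_eq L) (projT2 T) &
    ~ h_conseq y -> sat (eq_imp_eq L) (projT2 T) /\ ~ sat (sval y) (projT2 T)].
Proof.
move=> noh y; apply: contrapT => noT; apply: noh.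
exists (sval y); first exact: svalP.
apply: equivalent_in_Th => M CM v; have [yH|nyH] := pselect (h_conseq y).
  split=> [|yv]; first exact: yH.
  by apply: contrapT => ntv; apply: noT; exists (existT _ M v).
exfalso; apply: nyH => M' CM' w tw; apply: contrapT => nyw.
apply: noT; exists (existT _ M' w); split=> //= yH; case: nyw; exact: yH.
Qed.

Lemma atomless_supp_h_formula :
  (forall (X : Type) (J : ideal X) (M : X -> structure L),
     (forall i, C (M i)) -> atomless (powerset_mod J) -> supp_interpretable J M) ->
  exists2 phi : formula L 4, h_formula phi & equivalent_in (Th C) (eq_imp_eq L) phi.
Proof.
move=> interp; apply: contrapT => /h_counterexamples/choice[T TP].
pose M (i : hform * nat) := projT1 (T i.1).
have CM i : C (M i) by case: (TP i.1).
pose a j : dprod M := fun i => projT2 (T i.1) j.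
(* In the columns of [h_conseq] the tuple [b] repeats one element four times, which makes
   [eq_imp_eq] trivially true; in the others it coincides with [a], where [eq_imp_eq] holds by
   choice. *)
pose b j : dprod M := fun i =>
  if pselect (h_conseq i.1) then projT2 (T i.1) ord0 else projT2 (T i.1) j.
have theta_b i : sat (eq_imp_eq L) (coord b i).
  rewrite /coord /b; case: pselect => [//|nH].
  by case: (TP i.1) => _ _ /(_ nH)[].
have [chi chiP] := supp_interpretable_le (interp _ _ M CM h_ideal_atomless).
have [I [F [hF FP]]] := atomless_h_determined M h_ideal_atomless chi.
have same i : sat (F i) (fun j => rclass h_ideal (a j) : reduced_product h_ideal M) <->
    sat (F i) (fun j => rclass h_ideal (b j) : reduced_product h_ideal M).
  rewrite !sat_h_formula //; pose phi : hform := exist _ (F i) (hF i).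
  have [phiH|nphiH] := pselect (h_conseq phi).
    split=> _; first by apply: ae_all => k; apply: phiH (CM k) _ (theta_b k).
    (* For [a], the formula [phi] itself witnesses nullity: outside [h_conseq] it follows from
       [eq_imp_eq], and inside from [y] whenever [y] entails it; the remaining columns are ignored
       by the ideal. *)
    exists phi => // y; have [_ yH ynH] := TP y.
    have [Hy|nHy] := pselect (h_conseq y); last first.
      right; exists 0 => n _; apply; have [ty _] := ynH nHy.
      exact: phiH (CM (y, n)) _ ty.
    have [yphi|nyphi] := pselect (entails (sval y) (F i)); last by left.
    right; exists 0 => n _; apply; have [sy _] := yH Hy.
    exact: yphi (CM (y, n)) _ sy.
  (* In the whole column of [phi], [a] and [b] agree and refute [phi], and this column is not
     null. *)
  have [_ _ /(_ nphiH) [_ nphi]] := TP phi.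
  split=> aeF; exfalso; apply: (h_ideal_column nphiH _ aeF) => n //=.
  by rewrite /coord /b; case: pselect.
(* By [same], [chi] cannot separate [a] from [b]; but [b] satisfies [eq_imp_eq] everywhere, while
   [a] refutes it in all columns of [h_conseq]. *)
have := FP _ _ same; rewrite !chiP !supp_le_eq_imp_eq => -[_ /(_ (ae_all _ theta_b))].
apply: h_null_conseq => y n /= yH; case: (TP y) => _ /(_ yH)[_ nt] _.
exact: nt.
Qed.

End Counterexamples.

(** * From an h-formula to interpretability, and the equivalence *)

Lemma h_formula_supp_interpretable (L : language) (C : structure L -> Prop)
    (phi : formula L 4) : full_class C -> h_formula phi ->
  equivalent_in (Th C) (eq_imp_eq L) phi ->
  forall (X : Type) (J : ideal X) (M : X -> structure L),
    (forall i, C (M i)) -> supp_interpretable J M.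
Proof.
move=> fullC hphi phiE X J M CM; apply: supp_le_interpretable.
  apply: supp2_surj => i; have [_ [x [y [z [xy _ _]]]]] := fullC _ (CM i).
  by exists x, y.
exists phi => v; have [a ->] := rclass_repr_tuple v.
rewrite sat_h_formula // supp_le_eq_imp_eq; apply: ae_iff => i.
by apply: iff_sym; apply: phiE => s; apply.
Qed.

Theorem theorem2p14 (L : language) (C : structure L -> Prop)
    (fullC : full_class C) :
  [<-> (* 1 *)
       forall (X : Type) (J : ideal X) (M : X -> structure L),
         (forall i, C (M i)) -> supp_interpretable J M;
       (* 2 *)
       forall (X : Type) (J : ideal X) (M : X -> structure L),
         (forall i, C (M i)) -> atomless (powerset_mod J) ->
         supp_interpretable J M;
       (* 3 *)
       exists2 phi : formula L 4,
         h_formula phi & equivalent_in (Th C) (eq_imp_eq L) phi].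
Proof.
tfae.
- by move=> H X J M CM _; apply: H.
- exact: atomless_supp_h_formula.
- by move=> [phi hphi phiE]; apply: h_formula_supp_interpretable phiE.
Qed.
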